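(* Let $G$ be an arbitrary quiver with $n$ vertices. Then for all $1\le k\le n$: (a) $D_k \leq S_k$; (b) $S_k \leq 2 D_k$; (c) $D_k \leq B_{k-1}$; (d) $S_k \leq H_k$.
   Context: A quiver $G$ is a finite undirected graph with $n\ge 1$ vertices in which loops (possibly several at the same vertex) and multiple edges between distinct vertices are allowed; finite simple graphs are the special case without loops and multiple connections. $m$ is the total number of edges, where every loop and every edge of a multiple connection is counted. The Kirchhoff matrix $K$ of $G$ is the symmetric $n\times n$ matrix with $K_{ij}=-(\text{number of edges between } i \text{ and } j)$ for $i\neq j$, and $K_{ii}=$ the degree of vertex $i$, i.e. the number of edges attached to $i$, counted with multiplicity, where each loop at $i$ counts as $1$. Let $d_1\ge d_2\ge\dots\ge d_n$ be the vertex degrees (the diagonal entries of $K$) in non-increasing order and $\lambda_1\ge\lambda_2\ge\dots\ge\lambda_n$ the eigenvalues of $K$. Set $D_k=\sum_{j=1}^k d_j$ and $S_k=\sum_{j=1}^k\lambda_j$. The redundancy $r$ is the minimal number of edges whose removal leaves no multiple connections between distinct vertices; equivalently $r=\sum_{i<j}(\mathrm{sign}(K_{ij})-K_{ij})$ (multiple loops at a vertex do not count as redundant). Set $B_k=m+r+k(k+1)/2$ (so $B_{k-1}=m+r+k(k-1)/2$ and $B_0=m+r$) and $H_k=m+r+k^2$. *)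

(* Defs.v *)
From HB Require Import structures.
From mathcomp Require Import all_boot all_order all_algebra.
From mathcomp Require Import complex.

Set Implicit Arguments.
Unset Strict Implicit.
Unset Printing Implicit Defensive.

Import Order.TTheory GRing.Theory Num.Theory.

Local Open Scope ring_scope.

(* An edge is an element of a finite type carrying the set of its end points:
   one end point for a loop, two for any other edge.  Distinct edges may have
   the same end points, so parallel edges and repeated loops are allowed. *)
Record quiver (n : nat) := Quiver {
  edge : finType;
  ends : edge -> {set 'I_n};
  card_ends : forall e, (0 < #|ends e| <= 2)%N
}.

Section Quiver.
Variables (n : nat) (G : quiver n).

Definition nb_edges : nat := #|edge G|.

Definition mult (i j : 'I_n) : nat :=
  #|[set e : edge G | ends e == [set i; j]]|.

(* A loop at [i] counts once. *)
Definition degree (i : 'I_n) : nat := #|[set e : edge G | i \in ends e]|.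

Definition kirchhoff (R : pzRingType) : 'M[R]_n :=
  \matrix_(i, j) if i == j then (degree i)%:R else - (mult i j)%:R.

Definition degree_seq : seq nat := sort geq [seq degree i | i <- enum 'I_n].

Definition no_multiple_connection_without (F : {set edge G}) : bool :=
  [forall i : 'I_n, forall j : 'I_n, (i != j) ==>
     (#|[set e : edge G | (e \notin F) && (ends e == [set i; j])]| <= 1)%N].

(* The default [setT] is admissible, so this is a genuine minimum. *)
Definition redundancy : nat :=
  #|[arg min_(F < [set: edge G] | no_multiple_connection_without F) #|F| ]%N|.

Definition degree_sum (k : nat) : nat := (\sum_(d <- take k degree_seq) d)%N.

Definition bound_B (k : nat) : nat := (nb_edges + redundancy + (k * k.+1) %/ 2)%N.

Definition bound_H (k : nat) : nat := (nb_edges + redundancy + k ^ 2)%N.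

End Quiver.

(* [lam] lists all eigenvalues of [A], with multiplicity, in non-increasing
   order. *)
Definition spectrum (R : rcfType) n (A : 'M[R]_n) (lam : n.-tuple R) : Prop :=
  sorted >=%R lam /\ char_poly A = \prod_(x <- lam) ('X - x%:P).

Definition eigen_sum (R : rcfType) n (lam : n.-tuple R) (k : nat) : R :=
  \sum_(x <- take k lam) x.

Lemma kirchhoff_sym n (G : quiver n) (R : pzRingType) :
  (kirchhoff G R)^T = kirchhoff G R.
Proof.
apply/matrixP=> i j; rewrite !mxE eq_sym; case: eqP => [->//|_].
by rewrite /mult setUC.
Qed.

Lemma char_poly_similar (F : fieldType) n (P A B : 'M[F]_n) :
  P \in unitmx -> A = invmx P *m B *m P -> char_poly A = char_poly B.
Proof.
move=> uP ->; rewrite /char_poly /char_poly_mx !map_mxM.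
set p := map_mx _ P; set q := map_mx _ (invmx P).
have qp : q *m p = 1%:M by rewrite -map_mxM mulVmx // map_mx1.
have -> : 'X%:M - q *m map_mx polyC B *m p
          = q *m ('X%:M - map_mx polyC B) *m p.
  by rewrite mulmxBr mulmxBl (scalar_mxC _ q) -(mulmxA _ q p) qp mulmx1.
by rewrite !det_mulmx mulrAC -det_mulmx qp det1 mul1r.
Qed.

Lemma spectrum_exists (R : rcfType) n (A : 'M[R]_n) :
  A^T = A -> exists lam : n.-tuple R, spectrum A lam.
Proof.
move=> symA; pose AC : 'M[R[i]]_n := map_mx (real_complex R) A.
have hermA : AC \is hermsymmx.
  apply/is_hermitianmxP/matrixP=> i j; rewrite expr0 scale1r !mxE.
  by rewrite -[in LHS]symA mxE; exact/esym/conjc_real.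
have /orthomx_spectralP/(char_poly_similar (spectral_unit AC)) charA :=
  hermitian_normalmx hermA.
have /mxOverP sp_real := hermitian_spectral_diag_real hermA.
set sp := spectral_diag AC in charA sp_real.
pose s := [seq complex.Re (sp 0 i) | i <- enum 'I_n].
have spE i : (complex.Re (sp 0 i))%:C%C = sp 0 i by exact/RRe_real/sp_real.
have szs : size (sort >=%R s) == n by rewrite size_sort size_map size_enum_ord.
exists (Tuple szs); split=> /=.
  by apply: sort_sorted => x y; exact: le_total.
apply: (map_poly_inj (real_complex R)).
rewrite map_char_poly -/AC charA char_poly_trig ?diag_mx_is_trig //.
rewrite rmorph_prod /= (perm_big s) ?perm_sort //= big_map big_enum /=.
apply: eq_bigr => i _.
by rewrite rmorphB /= map_polyX map_polyC /= mxE eqxx mulr1n spE.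
Qed.

(* Main.v *)
Require Import Defs.
From mathcomp Require Import all_boot all_order all_algebra.
From mathcomp Require Import perm spectral complex.
From mathcomp Require Import ring lra zify.

Set Implicit Arguments.
Unset Strict Implicit.
Unset Printing Implicit Defensive.

Import Order.TTheory GRing.Theory Num.Theory.

Local Open Scope ring_scope.

(* Let X be the real part of the orthogonal projection onto the span of the
   first k eigenvectors, with diagonal p.  Then S_k = tr (X K) is a sum over the
   edges, where a loop at i contributes p_i <= 1 and an edge {i, j} contributes
   c_ij = p_i + p_j - 2 X_ij.  For (b), c_ij <= 2 (p_i + p_j).  For (c) the same
   edge sum is applied to the coordinate projection on the k vertices of largest
   degree.  For (d), redundant edges are paid for by c_ij <= 2, and for the
   others, with phi(p) = (2 + 3p) / (4 (1 - p)),
     c_ij <= 1 + 3/2 p_i p_j + X_ij^2 (phi(p_i) + phi(p_j)).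
   As the p_i add up to k and the squares X_ij^2 with j <> i to at most
   p_i (1 - p_i), this gives S_k <= m + r + 3/4 k^2 + k/2, which is enough when
   k >= 2.  For k = 1 the Anderson-Morley bound lambda_1 <= d_i + d_j reduces (d)
   to (c).  Part (a) is Schur's majorization inequality. *)

(** * Diagonalization over the complex numbers, read off in real matrices *)

Lemma ReM_sum (R : rcfType) (I : finType) (u v : I -> R[i]) :
  complex.Re (\sum_i u i * (v i)^*%C)
    = \sum_i (complex.Re (u i) * complex.Re (v i)
              + complex.Im (u i) * complex.Im (v i)).
Proof.
rewrite (big_morph (@complex.Re R) (id1 := 0) (op1 := +%R)) //; last by case=> ? ? [].
by apply: eq_bigr => i _; case: (u i) (v i) => [a b] [c d] /=; ring.
Qed.

Lemma ImM_sum (R : rcfType) (I : finType) (u v : I -> R[i]) :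
  complex.Im (\sum_i u i * (v i)^*%C)
    = \sum_i (complex.Im (u i) * complex.Re (v i)
              - complex.Re (u i) * complex.Im (v i)).
Proof.
rewrite (big_morph (@complex.Im R) (id1 := 0) (op1 := +%R)) //; last by case=> ? ? [].
by apply: eq_bigr => i _; case: (u i) (v i) => [a b] [c d] /=; ring.
Qed.

Section Diagonalization.
Variables (R : rcfType) (n : nat) (A : 'M[R]_n) (lam : n.-tuple R).
Hypotheses (symA : A^T = A) (lamP : spectrum A lam).

Let Lam : 'M[R]_n := diag_mx (\row_i tnth lam i).

(** The spectral theorem gives a unitary [S] and real eigenvalues in an unspecified order. Comparing
    characteristic polynomials shows that they are a permutation of [lam], and permuting the rows of
    [S] accordingly restores the order. *)
Lemma unitary_diagonalization :
  exists U : 'M[R[i]]_n,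
    U *m (map_mx conjc U)^T = 1%:M
    /\ U *m map_mx (real_complex R) A = map_mx (real_complex R) Lam *m U.
Proof.
pose AC : 'M[R[i]]_n := map_mx (real_complex R) A.
have hermA : AC \is hermsymmx.
  apply/is_hermitianmxP/matrixP=> i j; rewrite expr0 scale1r !mxE.
  by rewrite -[in LHS]symA mxE; exact/esym/conjc_real.
have /orthomx_spectralP defA := hermitian_normalmx hermA.
have charA := char_poly_similar (spectral_unit AC) defA.
have /mxOverP sp_real := hermitian_spectral_diag_real hermA.
have /unitarymxP := spectral_unitarymx AC.
have := spectral_unit AC.
move: (spectral_diag AC) (spectralmx AC) charA defA sp_real => sp S charA defA sp_real unitS S1.
pose s := [tuple complex.Re (sp 0 i) | i < n].
have spE i : (complex.Re (sp 0 i))%:C%C = sp 0 i by exact/RRe_real/sp_real.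
have /tuple_permP[p lamE] : perm_eq lam s.
  apply: prod_XsubC_eq; rewrite -(proj2 lamP).
  apply: (map_poly_inj (real_complex R)).
  rewrite map_char_poly.
  rewrite charA.
  rewrite char_poly_trig; last exact: diag_mx_is_trig.
  rewrite rmorph_prod /= big_map big_enum /=.
  apply: eq_bigr => i _.
  by rewrite rmorphB /= map_polyX map_polyC /= mxE eqxx mulr1n spE.
have lamE' a : (tnth lam a)%:C%C = sp 0 (p a).
  rewrite (tnth_nth 0) lamE -(tnth_nth 0 [tuple _ | i < n]) tnth_mktuple.
  by rewrite tnth_mktuple spE.
have SA : S *m AC = diag_mx sp *m S by rewrite defA -mulmxA mulKVmx //.
exists (row_perm p S); split.
  apply/matrixP=> a b.
  have /matrixP/(_ (p a) (p b)) := S1; rewrite !mxE (inj_eq perm_inj) => <-.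
  by apply: eq_bigr => j _; rewrite !mxE.
apply/matrixP=> a b; have /matrixP/(_ (p a) b) := SA.
rewrite mul_diag_mx map_diag_mx mul_diag_mx !mxE => e.
transitivity (sp 0 (p a) * S (p a) b); last by rewrite -lamE'.
rewrite -e.
by apply: eq_bigr => j _; rewrite !mxE.
Qed.

(** With U = B + iC, these are real and imaginary parts of U U^* = 1, U^* U = 1 and U A = Lam U,
    where A and Lam are real. *)
Lemma real_diagonalization :
  exists B C : 'M[R]_n,
    [/\ B *m B^T + C *m C^T = 1%:M, B *m C^T = C *m B^T,
        B^T *m B + C^T *m C = 1%:M, B *m A = Lam *m B & C *m A = Lam *m C].
Proof.
have [U [U1 UA]] := unitary_diagonalization.
have U2 := mulmx1C U1.
exists (map_mx (@complex.Re R) U), (map_mx (@complex.Im R) U).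
have col (a b : 'I_n) : \sum_j U a j * (U b j)^*%C = (a == b)%:R.
  have /matrixP/(_ a b) := U1; rewrite !mxE => <-.
  by apply: eq_bigr => j _; rewrite !mxE.
have row (a b : 'I_n) : \sum_j U j a * (U j b)^*%C = (a == b)%:R.
  have /matrixP/(_ b a) := U2; rewrite !mxE eq_sym => <-.
  by apply: eq_bigr => j _; rewrite !mxE mulrC.
have eig a b : \sum_j U a j * ((A j b)%:C%C)^*%C = (tnth lam a)%:C%C * U a b.
  have /matrixP/(_ a b) := UA; rewrite map_diag_mx mul_diag_mx !mxE.
  move=> e; transitivity ((tnth lam a)%:C%C * U a b) => //; rewrite -e.
  by apply: eq_bigr => j _; rewrite !mxE conjc_real.
have Re_nat (b : bool) : complex.Re (b%:R : R[i]) = b%:R by case: b.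
have Im_nat (b : bool) : complex.Im (b%:R : R[i]) = 0 by case: b.
split; apply/matrixP=> a b.
- rewrite !mxE -big_split /= -Re_nat -col ReM_sum.
  by apply: eq_bigr => j _; rewrite !mxE.
- have /(congr1 (@complex.Im R)) := col a b.
  rewrite ImM_sum sumrB Im_nat => /eqP; rewrite subr_eq0 eq_sym => /eqP e.
  rewrite !mxE; under eq_bigr do rewrite !mxE.
  by rewrite e; apply: eq_bigr => j _; rewrite !mxE.
- rewrite !mxE -big_split /= -Re_nat -row ReM_sum.
  by apply: eq_bigr => j _; rewrite !mxE.
- have /(congr1 (@complex.Re R)) := eig a b; rewrite ReM_sum mul_diag_mx !mxE.
  move=> e; transitivity (complex.Re ((tnth lam a)%:C%C * U a b)).
    by rewrite -e; apply: eq_bigr => j _; rewrite !mxE /=; ring.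
  by case: (U a b) => ? ? /=; ring.
- have /(congr1 (@complex.Im R)) := eig a b; rewrite ImM_sum mul_diag_mx !mxE.
  move=> e; transitivity (complex.Im ((tnth lam a)%:C%C * U a b)).
    by rewrite -e; apply: eq_bigr => j _; rewrite !mxE /=; ring.
  by case: (U a b) => ? ? /=; ring.
Qed.
End Diagonalization.

(** * Fractional weights against the k largest values *)

(** For a threshold t separating the first k values from the rest, right minus left is the sum of (1
    - c)(f - t) over the top and c (t - f) over the bottom; the terms in t cancel because the
    weights add up to k. *)
Lemma weighted_sum_le_top (R : realDomainType) (I : finType) (s : seq I)
    (f c : I -> R) (k : nat) :
    perm_eq s (enum I) -> sorted (fun i j => f j <= f i) s ->
    (forall i, 0 <= c i <= 1) -> \sum_i c i = k%:R -> (0 < k <= size s)%N ->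
  \sum_i c i * f i <= \sum_(i <- take k s) f i.
Proof.
move=> sE s_sorted c01 csum /andP[k_gt0 k_le].
have tot g : \sum_i g i = \sum_(i <- take k s) g i + \sum_(i <- drop k s) g i :> R.
  by rewrite -big_cat cat_take_drop (perm_big _ sE) /= big_enum.
have [t ht hd] : exists2 t, {in take k s, forall i, t <= f i}
                          & {in drop k s, forall i, f i <= t}.
  case: s => [|x0 s0] in k_le s_sorted sE tot *; first by move: k_gt0 k_le; case: (k).
  set s := x0 :: s0 in k_le s_sorted sE tot *.
  have mono i j : (i <= j < size s)%N -> f (nth x0 s j) <= f (nth x0 s i).
    move=> /andP[ij jn]; apply: (sorted_leq_nth _ _ x0 s_sorted) => //.
    - by move=> x y z ? /le_trans; apply.
    - by rewrite inE (leq_ltn_trans ij).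
  (* The threshold is the k-th largest value, at index [k.-1]. *)
  exists (f (nth x0 s k.-1)) => i /(nthP x0)[j].
    rewrite size_takel // => jk <-; rewrite nth_take //; apply: mono.
    by rewrite -ltnS prednK // jk.
  rewrite size_drop nth_drop => jk <-; apply: mono.
  by rewrite (leq_trans (leq_pred k)) ?leq_addr //= -ltn_subRL.
have tsum : \sum_(i <- take k s) (1 : R) = k%:R.
  by rewrite big_const_seq count_predT size_takel // iter_addr_0.
have sum_t : t * k%:R = \sum_(i <- take k s) c i * t + \sum_(i <- drop k s) c i * t.
  by rewrite -tot -mulr_suml csum mulrC.
rewrite tot -subr_ge0.
have top_ge0 : 0 <= \sum_(i <- take k s) (1 - c i) * (f i - t).
  rewrite big_seq sumr_ge0 // => i /ht fi; have := c01 i => /andP[_ ci].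
  by rewrite mulr_ge0 ?subr_ge0.
have bot_ge0 : 0 <= \sum_(i <- drop k s) c i * (t - f i).
  rewrite big_seq sumr_ge0 // => i /hd fi; have := c01 i => /andP[ci _].
  by rewrite mulr_ge0 ?subr_ge0.
have top_eq : \sum_(i <- take k s) (1 - c i) * (f i - t)
    = \sum_(i <- take k s) f i - t * k%:R - \sum_(i <- take k s) c i * f i
      + \sum_(i <- take k s) c i * t.
  rewrite -tsum mulr_sumr -!sumrB -big_split /=.
  by apply: eq_bigr => i _; ring.
have bot_eq : \sum_(i <- drop k s) c i * (t - f i)
    = \sum_(i <- drop k s) c i * t - \sum_(i <- drop k s) c i * f i.
  by rewrite -sumrB; apply: eq_bigr => i _; ring.
move: top_ge0 bot_ge0; rewrite top_eq bot_eq sum_t; lra.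
Qed.

Lemma eigen_sumE (R : rcfType) n (lam : n.-tuple R) k : (k <= n)%N ->
  eigen_sum lam k = \sum_(i < n | (i < k)%N) tnth lam i.
Proof.
move=> kn; rewrite /eigen_sum (big_nth 0) size_takel ?size_tuple // big_mkord.
under eq_bigr => i _ do rewrite nth_take //.
rewrite (big_ord_widen n (nth 0 lam)) //.
by apply: eq_bigr => i _; rewrite (tnth_nth 0).
Qed.

(** * Schur's inequality and spectral projections *)

Section SymmetricMatrix.
Variables (R : rcfType) (n : nat) (A : 'M[R]_n) (lam : n.-tuple R).
Hypotheses (symA : A^T = A) (lamP : spectrum A lam).

(** Each diagonal entry averages the eigenvalues with the doubly stochastic weights |U_ai|^2. Summed
    over [T], the weights lie in [0, 1] and have total [#|T|]. *)
Lemma schur_top (T : {set 'I_n}) : (0 < #|T|)%N ->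
  \sum_(i in T) A i i <= eigen_sum lam #|T|.
Proof.
move=> T_gt0; have Tn : (#|T| <= n)%N by rewrite -[X in (_ <= X)%N]card_ord max_card.
have [B [C [ortho _ ortho' BA CA]]] := real_diagonalization symA lamP.
pose w a i := B a i ^+ 2 + C a i ^+ 2.
have w_ge0 a i : 0 <= w a i by rewrite addr_ge0 ?sqr_ge0.
have row_sum a : \sum_i w a i = 1.
  have /matrixP/(_ a a) := ortho; rewrite !mxE eqxx => e.
  transitivity ((nat_of_bool true)%:R : R) => //; rewrite -e -big_split.
  by apply: eq_bigr => i _; rewrite !mxE.
have col_sum i : \sum_a w a i = 1.
  have /matrixP/(_ i i) := ortho'; rewrite !mxE eqxx => e.
  transitivity ((nat_of_bool true)%:R : R) => //; rewrite -e -big_split.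
  by apply: eq_bigr => a _; rewrite !mxE.
have AE i : A i i = \sum_a w a i * tnth lam a.
  rewrite -[A in LHS]mul1mx -ortho' mulmxDl -!mulmxA BA CA !mul_diag_mx.
  rewrite !mxE -big_split; apply: eq_bigr => a _; rewrite !mxE /w /=; ring.
pose c a := \sum_(i in T) w a i.
have -> : \sum_(i in T) A i i = \sum_a c a * tnth lam a.
  under eq_bigr do rewrite AE.
  by rewrite exchange_big; apply: eq_bigr => a _; rewrite /c mulr_suml.
rewrite /eigen_sum -[X in take _ X]map_tnth_enum -map_take big_map.
apply: weighted_sum_le_top => //.
- have [lam_sorted _] := lamP.
  by move: lam_sorted; rewrite -{1}[tval lam]map_tnth_enum sorted_map.
- move=> a; rewrite sumr_ge0 //=; rewrite -(row_sum a) [leRHS](bigID (mem T)) /=.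
  by rewrite lerDl sumr_ge0.
- rewrite exchange_big /=; under eq_bigr do rewrite col_sum.
  by rewrite sumr_const.
- by rewrite T_gt0 size_enum_ord.
Qed.

(* X and Y are the real and imaginary parts of a complex orthogonal projection
   Q, and the second conjunct is the real part of Q = Q *m Q^*. *)
Lemma top_eigenprojection (k : nat) : (k <= n)%N ->
  exists X Y : 'M[R]_n,
    [/\ X^T = X, X = X *m X^T + Y *m Y^T, \tr X = k%:R
      & \tr (X *m A) = eigen_sum lam k].
Proof.
move=> kn; have [B [C [ortho comm _ BA CA]]] := real_diagonalization symA lamP.
pose e : 'rV[R]_n := \row_i (i < k)%:R; pose E := diag_mx e.
have EE : E *m E = E.
  rewrite /E mulmx_diag; congr diag_mx; apply/rowP=> i; rewrite !mxE.
  by case: (_ < _)%N; rewrite ?mulr1 ?mulr0.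
have ET : E^T = E by exact: tr_diag_mx.
(* Real and imaginary part of Q = U^* E U with U = B + iC, where [E] selects the first k
   coordinates. *)
pose X := B^T *m E *m B + C^T *m E *m C.
pose Y := B^T *m E *m C - C^T *m E *m B.
have XT : X^T = X by rewrite /X linearD /= !trmx_mul !trmxK ET !mulmxA.
exists X, Y; split=> //.
- have YT : Y^T = C^T *m E *m B - B^T *m E *m C.
    by rewrite /Y linearB /= !trmx_mul !trmxK ET !mulmxA.
  rewrite XT YT /X /Y.
  set b := B^T *m E; set c := C^T *m E.
  (* In the expansion of X X^T + Y Y^T, [key] collapses the four terms that give back [X], and
     [swap] cancels the others in pairs. *)
  have key (u v : 'M[R]_n) : u *m E *m (B *m B^T) *m E *m v
       + u *m E *m (C *m C^T) *m E *m v = u *m E *m v.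
    by rewrite -!mulmxDl -mulmxDr ortho mulmx1 -(mulmxA u E E) EE.
  have swap (u v : 'M[R]_n) : u *m E *m (B *m C^T) *m E *m v
      = u *m E *m (C *m B^T) *m E *m v by rewrite comm.
  have /= bb := key B^T B; have /= cc := key C^T C.
  have /= bc := swap B^T C; have /= cb := swap C^T B.
  rewrite -{1}bb -{1}cc /b /c !(mulmxDl, mulmxDr, mulNmx, mulmxN) !mulmxA.
  move: bc cb; rewrite !mulmxA => -> ->.
  have gen (p q r t u v : 'M[R]_n) :
      p + q + (r + t) = p + u + (v + t) + (q - u + (- v - - r)).
    by apply/matrixP=> i j; rewrite !mxE; ring.
  exact: gen.
- rewrite /X linearD /= -!mulmxA !(mxtrace_mulC _ (E *m _)) -!mulmxA -linearD /=.
  rewrite -mulmxDr ortho mulmx1 mxtrace_diag.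
  under eq_bigr do rewrite mxE.
  rewrite -[k in RHS]card_ord -sum1_card natr_sum (big_ord_widen n (fun=> 1)) //.
  by rewrite [RHS]big_mkcond; apply: eq_bigr => i _; case: (_ < _)%N.
- rewrite /X mulmxDl linearD /= -!mulmxA BA CA.
  rewrite ![\tr (_^T *m _)]mxtrace_mulC -!mulmxA -linearD /=.
  rewrite -!mulmxDr ortho mulmx1 mulmx_diag mxtrace_diag eigen_sumE //.
  rewrite [RHS]big_mkcond; apply: eq_bigr => i _; rewrite !mxE.
  by case: (_ < _)%N; rewrite ?mul1r ?mul0r.
Qed.
End SymmetricMatrix.

(** * Entrywise bounds for the real part of a projection *)

Section RealPartOfProjection.
Variables (R : rcfType) (n : nat) (X Y : 'M[R]_n).
Hypothesis XE : X = X *m X^T + Y *m Y^T.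

(** [X] is the Gram matrix of the rows of the block matrix [X Y]; the bounds below come from sums of
    squares. *)
Let entryE i j : X i j = \sum_l (X i l * X j l + Y i l * Y j l).
Proof.
rewrite [in LHS]XE !mxE -big_split.
by apply: eq_bigr => l _; rewrite !mxE.
Qed.

Lemma projection_diff_ge0 i j : 0 <= X i i + X j j - 2%:R * X i j.
Proof.
rewrite !entryE mulr_sumr -big_split -sumrB sumr_ge0 //= => l _.
have := sqr_ge0 (X i l - X j l); have := sqr_ge0 (Y i l - Y j l); nra.
Qed.

Lemma projection_sum_ge0 i j : 0 <= X i i + X j j + 2%:R * X i j.
Proof.
rewrite !entryE mulr_sumr -!big_split sumr_ge0 //= => l _.
have := sqr_ge0 (X i l + X j l); have := sqr_ge0 (Y i l + Y j l); nra.
Qed.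

Lemma projection_row_le i : \sum_(j | j != i) X i j ^+ 2 <= X i i * (1 - X i i).
Proof.
rewrite mulrBr mulr1 lerBrDr -expr2 addrC.
have -> : X i i ^+ 2 + \sum_(j | j != i) X i j ^+ 2 = \sum_j X i j ^+ 2.
  by rewrite [RHS](bigD1 i).
rewrite [leRHS]entryE.
by apply: ler_sum => j _; rewrite -!expr2 lerDl sqr_ge0.
Qed.

Lemma projection_diag i : 0 <= X i i <= 1.
Proof.
have p_ge0 : 0 <= X i i.
  by rewrite entryE sumr_ge0 // => j _; rewrite -!expr2 addr_ge0 ?sqr_ge0.
have : 0 <= X i i * (1 - X i i).
  by apply: le_trans (projection_row_le i); apply: sumr_ge0 => j _; apply: sqr_ge0.
have [->|p_neq0] := eqVneq (X i i) 0; first by rewrite lexx ler01.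
by rewrite p_ge0 pmulr_rge0 ?lt0r ?p_neq0 // subr_ge0.
Qed.

End RealPartOfProjection.

(** This is [projection_diff_ge0] for the complementary projection 1 - Q: its real part is 1 - X,
    and its imaginary part -Y has the same Gram matrix as [Y]. *)
Lemma projection_diff_le2 (R : rcfType) n (X Y : 'M[R]_n) (i j : 'I_n) :
    X^T = X -> X = X *m X^T + Y *m Y^T -> i != j ->
  X i i + X j j - 2%:R * X i j <= 2%:R.
Proof.
move=> XT XE ij; pose Z := 1%:M - X.
have ZE : Z = Z *m Z^T + Y *m Y^T.
  rewrite /Z linearB /= trmx1 XT mulmxBl !mulmxBr !mul1mx mulmx1.
  rewrite XT in XE; have -> : Y *m Y^T = X - X *m X by apply/eqP; rewrite eq_sym subr_eq addrC -XE.
  by apply/matrixP=> a b; rewrite !mxE; ring.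
have := projection_diff_ge0 ZE i j; rewrite !mxE !eqxx (negbTE ij) /=; lra.
Qed.

(** * The inequality for a single edge *)

(* With s = p + q and t = p * q, right minus left is a concave quadratic in t,
   and it is nonnegative at the ends of the range
   max(0, s - 1) <= t <= s^2 / 4: kappa is the slope of the chord. *)
Lemma edge_weight_discriminant (R : realFieldType) (p q : R) :
  0 <= p <= 1 -> 0 <= q <= 1 ->
  4%:R * ((1 - p) * (1 - q))
    <= (3%:R / 2%:R * p * q + 1 - p - q)
       * ((2%:R + 3%:R * p) * (1 - q) + (2%:R + 3%:R * q) * (1 - p)).
Proof.
move=> /andP[p0 p1] /andP[q0 q1]; rewrite -subr_ge0.
set h := (X in 0 <= X).
(* Here d = s^2 / 4 - t, and [top] is the value of [h] at d = 0. In each case below, the term with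
   factor 9 is the excess over the chord; the chord is expanded from its lower end, so from the left
   if kappa >= 0 and from the right otherwise. *)
pose s := p + q; pose d := (p - q) ^+ 2 / 4%:R.
pose top := s * (2%:R - s) * (1 / 2%:R - 3%:R / 4%:R * s + 9%:R / 16%:R * s ^+ 2).
have s0 : 0 <= s by rewrite /s; lra.
have s2 : 0 <= 2%:R - s by rewrite /s; lra.
have d0 : 0 <= d by rewrite /d divr_ge0 ?sqr_ge0.
have pq0 : 0 <= p * q by rewrite mulr_ge0.
have u0 : 0 <= (1 - p) * (1 - q) by rewrite mulr_ge0 ?subr_ge0.
have top0 : 0 <= top.
  rewrite /top; apply: mulr_ge0; first exact: mulr_ge0.
  have := sqr_ge0 (3%:R / 4%:R * s - 1 / 2%:R); lra.
have [s1|s1] := lerP s 1.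
  pose kappa := 15%:R / 2%:R * s - 4%:R - 9%:R / 4%:R * s ^+ 2.
  have [k0|k0] := lerP 0 kappa.
    have -> : h = 9%:R * (p * q * d) + s * (1 - s) + kappa * (p * q).
      by rewrite /h /kappa /d /s; field.
    by do ?[assumption | lra | apply: addr_ge0 | apply: mulr_ge0].
  have -> : h = 9%:R * (p * q * d) + top + (- kappa) * d.
    by rewrite /h /kappa /top /d /s; field.
  by do ?[assumption | lra | apply: addr_ge0 | apply: mulr_ge0].
pose kappa := 5%:R - 3%:R / 2%:R * s - 9%:R / 4%:R * s ^+ 2.
have [k0|k0] := lerP 0 kappa.
  have -> : h = 9%:R * ((1 - p) * (1 - q) * d) + (s - 1) * (5%:R / 2%:R * (2%:R - s))
                + kappa * ((1 - p) * (1 - q)).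
    by rewrite /h /kappa /d /s; field.
  by do ?[assumption | lra | apply: addr_ge0 | apply: mulr_ge0].
have -> : h = 9%:R * ((1 - p) * (1 - q) * d) + top + (- kappa) * d.
  by rewrite /h /kappa /top /d /s; field.
by do ?[assumption | lra | apply: addr_ge0 | apply: mulr_ge0].
Qed.

(* The difference of the two sides is a quadratic in x, whose discriminant is
   controlled by the previous lemma.  At p = 1, phi takes the junk value 0,
   which is harmless because then x = 0. *)
Lemma edge_weight_ge (R : realFieldType) (p q x : R) :
  let phi p := (2%:R + 3%:R * p) / (4%:R * (1 - p)) in
  0 <= p <= 1 -> 0 <= q <= 1 -> x ^+ 2 <= p * (1 - p) -> x ^+ 2 <= q * (1 - q) ->
  p + q - 2%:R * x <= 1 + (3%:R / 2%:R * (p * q) + x ^+ 2 * (phi p + phi q)).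
Proof.
move=> phi p01 q01 xp xq.
have [p1|p1] := eqVneq p 1.
  have /eqP : x = 0.
    by apply/eqP; rewrite -sqrf_eq0 eq_le sqr_ge0 andbT (le_trans xp) // p1 subrr mulr0.
  by move=> /eqP ->; rewrite p1; lra.
have [q1|q1] := eqVneq q 1.
  have /eqP : x = 0.
    by apply/eqP; rewrite -sqrf_eq0 eq_le sqr_ge0 andbT (le_trans xq) // q1 subrr mulr0.
  by move=> /eqP ->; rewrite q1; lra.
have [p0 ple] := andP p01; have [q0 qle] := andP q01.
have a_gt0 : 0 < 1 - p by rewrite subr_gt0 lt_neqAle p1.
have b_gt0 : 0 < 1 - q by rewrite subr_gt0 lt_neqAle q1.
set c := 3%:R / 2%:R * p * q + 1 - p - q.
set F := (2%:R + 3%:R * p) * (1 - q) + (2%:R + 3%:R * q) * (1 - p).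
have cF : 4%:R * ((1 - p) * (1 - q)) <= c * F by exact: edge_weight_discriminant.
set d := 4%:R * ((1 - p) * (1 - q)) in cF.
have d_gt0 : 0 < d by rewrite !mulr_gt0.
have phiE : phi p + phi q = F / d.
  by rewrite /phi /F /d; field; rewrite !gt_eqF.
have F_gt0 : 0 < F.
  by rewrite /F addr_gt0 // mulr_gt0 //; lra.
rewrite phiE -subr_ge0.
(* Completing the square in x; the remainder is nonnegative by [cF]. *)
have -> : 1 + (3%:R / 2%:R * (p * q) + x ^+ 2 * (F / d)) - (p + q - 2%:R * x)
   = ((x * F + d) ^+ 2 + d * (c * F - d)) / (d * F).
  by rewrite /c; field; rewrite !gt_eqF.
by rewrite divr_ge0 ?addr_ge0 ?sqr_ge0 ?mulr_ge0 ?subr_ge0 // ltW.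
Qed.

(** * Counting edges and the trace as an edge sum *)

(** An edge at i has exactly one opposite end j, with j = i for a loop. *)
Lemma sum_eq_set2 (T : finType) (S : {set T}) (i : T) : (0 < #|S| <= 2)%N ->
  (\sum_(j : T) (S == [set i; j]) = (i \in S))%N.
Proof.
move=> /andP[S_gt0 S_le2]; have [iS|iS] := boolP (i \in S); last first.
  by rewrite big1 // => j _; apply/eqP; rewrite eqb0; apply: contra iS => /eqP->; rewrite set21.
have [x ->] : exists x, S = [set i; x].
  have [/eqP|[x xS]] := set_0Vmem (S :\ i).
    rewrite setD_eq0 => S1; exists i; rewrite setUid; apply/eqP.
    by rewrite eqEsubset S1 sub1set.
  exists x; apply/esym/eqP; rewrite eqEcard cards2 subUset !sub1set iS.
  by move: xS; rewrite !inE eq_sym => /andP[-> ->].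
rewrite (bigD1 x) //= eqxx big1 // => j jx; apply/eqP; rewrite eqb0.
apply/eqP => /setP E; move: (E x) (E j); rewrite !inE !eqxx !orbT (negbTE jx) orbF.
rewrite [x == j]eq_sym (negbTE jx) orbF => /esym/eqP xi /eqP ji.
by rewrite ji xi eqxx in jx.
Qed.

Section EdgeCount.
Variables (n : nat) (G : quiver n).
Implicit Types (F : {set edge G}) (i j : 'I_n).

Definition mult_in F i j : nat := #|[set e in F | ends e == [set i; j]]|.

Lemma mult_inT i j : mult_in [set: edge G] i j = mult G i j.
Proof. by apply: eq_card => e; rewrite !inE. Qed.

Lemma mult_inE F i j : mult_in F i j = (\sum_(e in F) (ends e == [set i; j]))%N.
Proof.
rewrite /mult_in -sum1_card [RHS]big_mkcond [LHS]big_mkcond; apply: eq_bigr => e _.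
by rewrite inE; case: (e \in F) (ends e == _) => [] [].
Qed.

Lemma multC i j : mult G i j = mult G j i.
Proof. by rewrite /mult setUC. Qed.

Lemma sum_mult i : (\sum_j mult G i j = degree G i)%N.
Proof.
under eq_bigr do rewrite -mult_inT mult_inE.
rewrite exchange_big /= /degree -sum1_card [RHS]big_mkcond [LHS]big_mkcond.
by apply: eq_bigr => e _; rewrite sum_eq_set2 ?card_ends // !inE; case: (_ \in _).
Qed.

(** An ordinary edge occurs in the double sum at (i, j) and at (j, i), a loop only at (i, i); the
    diagonal sum supplies the second count of the loops. *)
Lemma handshake F :
  (\sum_i \sum_j mult_in F i j + \sum_i mult_in F i i = 2 * #|F|)%N.
Proof.
have -> : (\sum_i \sum_j mult_in F i j = \sum_(e in F) #|ends e|)%N.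
  under eq_bigr => i _ do under eq_bigr => j _ do rewrite mult_inE.
  under eq_bigr => i _ do rewrite exchange_big /=.
  rewrite exchange_big /=; apply: eq_bigr => e _.
  under eq_bigr => i _ do rewrite sum_eq_set2 ?card_ends //.
  by rewrite -sum1_card [RHS]big_mkcond; apply: eq_bigr => i _; case: (_ \in _).
have -> : (\sum_i mult_in F i i = \sum_(e in F) (2 - #|ends e|))%N.
  under eq_bigr => i _ do rewrite mult_inE.
  rewrite exchange_big /=; apply: eq_bigr => e _.
  under eq_bigr => i _ do rewrite setUid.
  have := card_ends e; case: (boolP (#|ends e| == 1)%N) => [/cards1P[x ->]|e1] e2.
    rewrite cards1 (bigD1 x) //= eqxx big1 // => i ix.
    by rewrite (inj_eq set1_inj) eq_sym (negbTE ix).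
  rewrite big1 => [|i _]; first by move: e1 e2; case: #|ends e| => [|[|[|c]]].
  by apply/eqP; rewrite eqb0; apply: contra e1 => /eqP->; rewrite cards1.
rewrite -big_split /= -sum1_card big_distrr /=; apply: eq_bigr => e _.
by have := card_ends e; case: #|ends e| => [|[|[|c]]].
Qed.

Lemma redundancy_witness :
  exists2 F : {set edge G}, #|F| = redundancy G
    & forall i j, i != j -> (mult G i j - 1 <= mult_in F i j)%N.
Proof.
rewrite /redundancy; case: arg_minnP => [|F /forallP nmF _].
  apply/forallP=> i; apply/forallP=> j; apply/implyP=> _.
  rewrite (_ : [set _ | _] = set0) ?cards0 //.
  by apply/setP=> e; rewrite !inE.
exists F => // i j ij; have /forallP/(_ j)/implyP/(_ ij) := nmF i.
rewrite /mult /mult_in => cF.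
rewrite leq_subLR -(cardsID F [set e | ends e == [set i; j]]) addnC leq_add //.
  by apply: leq_trans cF; apply: subset_leq_card; apply/subsetP => e; rewrite !inE.
by apply: subset_leq_card; apply/subsetP => e; rewrite !inE andbC.
Qed.

(** Adds the handshake identities for all edges and for a minimal deletion set, which contains all
    but at most one of the edges between i and j. *)
Lemma edges_redundancy_ge :
  (2 * (\sum_i mult G i i)
     + \sum_i \sum_(j | j != i) (mult G i j + (mult G i j - 1))
   <= 2 * (nb_edges G + redundancy G))%N.
Proof.
have [F <- hF] := redundancy_witness.
have := handshake [set: edge G]; have := handshake F.
rewrite cardsT -/(nb_edges G).
under [X in _ -> (X + _ = _)%N -> _]eq_bigr => i _ do under eq_bigr => j _ do rewrite mult_inT.
under [X in _ -> (_ + X = _)%N -> _]eq_bigr => i _ do rewrite mult_inT.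
have split (f : 'I_n -> 'I_n -> nat) : (\sum_i \sum_j f i j = \sum_i f i i + \sum_i \sum_(j | j != i) f i j)%N.
  by rewrite -big_split; apply: eq_bigr => i _; rewrite (bigD1 i).
rewrite !split => hFc hG.
have exc : (\sum_i \sum_(j | j != i) (mult G i j - 1) <= \sum_i \sum_(j | j != i) mult_in F i j)%N.
  by apply: leq_sum => i _; apply: leq_sum => j ji; apply: hF; rewrite eq_sym.
have -> : (\sum_i \sum_(j | j != i) (mult G i j + (mult G i j - 1)) =
  \sum_i \sum_(j | j != i) mult G i j + \sum_i \sum_(j | j != i) (mult G i j - 1))%N.
  by rewrite -big_split; apply: eq_bigr => i _; rewrite big_split.
lia.
Qed.

Variables (R : realDomainType) (X : 'M[R]_n).
Hypothesis XT : X^T = X.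

(** Each degree is distributed over its incident edges. The factor 2 comes from symmetrizing over
    ordered pairs. *)
Lemma kirchhoff_trace :
  2%:R * \tr (X *m kirchhoff G R)
  = 2%:R * (\sum_i X i i * (mult G i i)%:R)
    + \sum_i \sum_(j | j != i) (X i i + X j j - 2%:R * X i j) * (mult G i j)%:R.
Proof.
have Xsym i j : X j i = X i j by rewrite -[in LHS]XT mxE.
pose s f : R := \sum_i \sum_(j | j != i) f i j * (mult G i j)%:R.
have s_swap f : s (fun i j => f j i) = s f.
  rewrite /s (exchange_big_dep predT) //=; apply: eq_bigr => i _.
  by apply: eq_big => [j|j _]; rewrite ?(multC i) // eq_sym.
have -> : \tr (X *m kirchhoff G R)
    = \sum_i X i i * (mult G i i)%:R + s (fun i j => X i i - X i j).
  rewrite /mxtrace /s -big_split /=; apply: eq_bigr => i _.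
  rewrite mxE (bigD1 i) //= mxE eqxx -sum_mult (bigD1 i) //= natrD mulrDr -addrA.
  congr (_ + _); rewrite natr_sum mulr_sumr -big_split /=; apply: eq_bigr => j ji.
  by rewrite mxE (negbTE ji) (multC j); ring.
have -> : \sum_i \sum_(j | j != i) (X i i + X j j - 2%:R * X i j) * (mult G i j)%:R
   = s (fun i j => X i i - X i j) + s (fun i j => X j j - X j i).
  rewrite /s -big_split; apply: eq_bigr => i _; rewrite -big_split.
  by apply: eq_bigr => j _; rewrite (Xsym i j) /=; ring.
by rewrite (s_swap (fun i j => X i i - X i j)); ring.
Qed.

(** Among parallel edges one is charged 1 + g and each other one 2, that is, 1 for the edge and 1
    for its redundancy. *)
Lemma kirchhoff_trace_le (g : 'I_n -> 'I_n -> R) :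
    (forall i, X i i <= 1) ->
    (forall i j, i != j -> X i i + X j j - 2%:R * X i j <= 2%:R) ->
    (forall i j, i != j -> 0 <= g i j) ->
    (forall i j, i != j -> X i i + X j j - 2%:R * X i j <= 1 + g i j) ->
  2%:R * \tr (X *m kirchhoff G R)
    <= 2%:R * (nb_edges G + redundancy G)%:R + \sum_i \sum_(j | j != i) g i j.
Proof.
move=> X1 c2 g0 c1; rewrite kirchhoff_trace.
have := edges_redundancy_ge; rewrite -(ler_nat R) natrD !natrM !natr_sum.
set rhs := 2%:R * (nb_edges G + redundancy G)%:R.
under [X in _ + X <= _ -> _]eq_bigr => i _ do rewrite natr_sum.
move=> le_rhs; apply: le_trans (lerD le_rhs (lexx _)).
rewrite -addrA; apply: lerD.
  by apply: ler_wpM2l => //; apply: ler_sum => i _; rewrite ler_piMl.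
rewrite -big_split; apply: ler_sum => i _; rewrite -big_split /=.
apply: ler_sum => j ji; rewrite eq_sym in ji.
have := c2 i j ji; have := g0 i j ji; have := c1 i j ji.
set c := _ - _; move=> cg1 gij0 cij2.
case: (mult G i j) => [|m]; first by rewrite mulr0 add0n add0r.
rewrite subn1 /= natrD -[m.+1]addn1 natrD.
have : c * m%:R <= 2%:R * m%:R by apply: ler_wpM2r.
lra.
Qed.

End EdgeCount.

(** * Sums of the largest degrees *)

Section DegreeSums.
Variables (n : nat) (G : quiver n).

(** Sorting vertices instead of degrees makes the k vertices of largest degree available as a
    set. *)
Let by_degree : seq 'I_n := sort (relpre (degree G) geq) (enum 'I_n).

Lemma degree_sumE k :
  degree_sum G k = (\sum_(i <- take k by_degree) degree G i)%N.
Proof. by rewrite /degree_sum /degree_seq sort_map -map_take big_map. Qed.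

Lemma degree_sum_set k : (k <= n)%N ->
  exists2 T : {set 'I_n}, #|T| = k & degree_sum G k = (\sum_(i in T) degree G i)%N.
Proof.
move=> kn; have u : uniq (take k by_degree) by rewrite take_uniq // sort_uniq enum_uniq.
exists [set i in take k by_degree].
  by rewrite cardsE (card_uniqP u) size_takel // size_sort size_enum_ord.
rewrite degree_sumE big_uniq //=; apply: eq_bigl => i; by rewrite inE.
Qed.

Lemma weighted_degree_le (R : realDomainType) (c : 'I_n -> R) k :
    (forall i, 0 <= c i <= 1) -> \sum_i c i = k%:R -> (0 < k <= n)%N ->
  \sum_i c i * (degree G i)%:R <= (degree_sum G k)%:R.
Proof.
move=> c01 csum kn; rewrite degree_sumE natr_sum.
apply: weighted_sum_le_top => //.
- by rewrite perm_sort.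
- have : sorted (relpre (degree G) geq) by_degree.
    by apply: sort_sorted => i j; exact: leq_total.
  by apply: sub_sorted => i j /=; rewrite ler_nat.
- by rewrite size_sort size_enum_ord.
Qed.

Lemma trace_diag_kirchhoff (R : pzRingType) (p : 'rV[R]_n) :
  \tr (diag_mx p *m kirchhoff G R) = \sum_i p 0 i * (degree G i)%:R.
Proof.
by rewrite mul_diag_mx; apply: eq_bigr => i _; rewrite !mxE eqxx.
Qed.

(** For the coordinate projection onto [T], an edge contributes t_i + t_j <= 1 + t_i t_j, and the
    products over ordered pairs add up to |T| (|T| - 1). *)
Lemma sum_degree_le (T : {set 'I_n}) :
  (2 * \sum_(i in T) degree G i
     <= 2 * (nb_edges G + redundancy G) + #|T| * (#|T|).-1)%N.
Proof.
pose t i : int := (i \in T)%:R; pose p := \row_i t i.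
have t01 i : t i = 0 \/ t i = 1 by rewrite /t; case: (i \in T); [right|left].
have := @kirchhoff_trace_le n G int (diag_mx p) (tr_diag_mx p) (fun i j => t i * t j).
have -> : \tr (diag_mx p *m kirchhoff G int) = (\sum_(i in T) degree G i)%:R.
  rewrite trace_diag_kirchhoff natr_sum [RHS]big_mkcond; apply: eq_bigr => i _.
  by rewrite mxE /t; case: (i \in T); rewrite ?mul1r ?mul0r.
have -> : \sum_i \sum_(j | j != i) t i * t j = (#|T| * #|T|.-1)%:R.
  have -> : \sum_i \sum_(j | j != i) t i * t j = \sum_(i in T) (#|T|.-1)%:R.
    rewrite [RHS]big_mkcond; apply: eq_bigr => i _; rewrite -mulr_sumr /t.
    case: ifP => iT; last by rewrite mul0r.
    rewrite mul1r (cardsD1 i) iT -sum1_card natr_sum big_mkcond [RHS]big_mkcond.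
    by apply: eq_bigr => j _; rewrite !inE; case: (j != i) (j \in T) => [] [].
  by rewrite sumr_const natrM mulr_natl.
rewrite -!natrM -natrD ler_nat; apply=> [i|i j ij|i j ij|i j ij];
  rewrite ?mxE ?eqxx ?(negbTE ij) /=.
- by case: (t01 i) => ->.
- by case: (t01 i) (t01 j) => -> [] ->.
- by case: (t01 i) (t01 j) => -> [] ->.
- by case: (t01 i) (t01 j) => -> [] ->.
Qed.

End DegreeSums.

(** * The bound on a single eigenvalue *)

Section Eigenvalue.
Variables (n : nat) (G : quiver n) (R : realFieldType).

(* Anderson and Morley: for an eigenvector v, compare at the edge where the
   difference of v (or the value of v, for a loop) is largest. *)
Lemma kirchhoff_eigenvalue_le (a : R) : eigenvalue (kirchhoff G R) a ->
  a <= (nb_edges G + redundancy G + 1)%:R.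
Proof.
case/eigenvalueP=> v vK v0.
pose y i j := if i == j then v 0 i else v 0 i - v 0 j.
have av i : a * v 0 i = \sum_j (mult G i j)%:R * y i j.
  have /rowP/(_ i) := vK; rewrite !mxE => <-.
  rewrite (bigD1 i) //= [RHS](bigD1 i) //= !mxE /y eqxx -sum_mult.
  rewrite (bigD1 i) //= natrD natr_sum mulrDr mulr_sumr -addrA mulrC.
  congr (_ + _); rewrite -big_split; apply: eq_bigr => j ji.
  by rewrite mxE (negbTE ji) eq_sym (negbTE ji) (multC _ j) /=; ring.
have a_eq0 : (forall i, a * v 0 i = 0) -> a = 0.
  move=> av0; apply/eqP; apply: contraNT v0 => a0; apply/eqP/rowP=> i.
  by apply: (mulfI a0); rewrite av0 mxE mulr0.
(* Without edges a = 0. Otherwise the maximum of |y| is taken over joined pairs, where i = j stands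
   for a loop. *)
have [p0 Pp0|noP] := pickP [pred p : 'I_n * 'I_n | (0 < mult G p.1 p.2)%N]; last first.
  rewrite a_eq0 ?ler0n // => i; rewrite av big1 // => j _.
  by have /= := noP (i, j); rewrite lt0n => /negbFE/eqP->; rewrite mul0r.
case: (arg_maxP (fun p : 'I_n * 'I_n => `|y p.1 p.2|) Pp0) => -[i j] /= Pij ymax.
set M := `|y i j| in ymax.
have av_le l : `|a * v 0 l| <= (degree G l)%:R * M.
  rewrite av -sum_mult natr_sum mulr_suml.
  apply: le_trans (ler_norm_sum _ _ _) _; apply: ler_sum => u _.
  rewrite normrM normr_nat.
  have [->|m0] := posnP (mult G l u); first by rewrite !mul0r.
  by apply: ler_wpM2l => //; exact: (ymax (l, u)).
have [M0|M_neq0] := eqVneq M 0.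
  rewrite a_eq0 ?ler0n // => l.
  by apply/eqP; rewrite -normr_le0 (le_trans (av_le l)) // M0 mulr0.
have M_gt0 : 0 < M by rewrite lt0r M_neq0 normr_ge0.
apply: le_trans (ler_norm a) _; rewrite -(ler_pM2r M_gt0).
apply: (@le_trans _ _ ((\sum_(l in [set i; j]) degree G l)%:R * M)).
  have -> : `|a| * M = `|a * y i j| by rewrite normrM.
  rewrite /y; have [ij|ij] := eqVneq i j.
    by rewrite -ij setUid big_set1.
  rewrite big_setU1 ?inE //= big_set1 natrD mulrDl mulrBr.
  apply: le_trans (ler_normB _ _) _; apply: lerD; exact: av_le.
rewrite ler_pM2r // ler_nat.
rewrite -(@leq_pmul2l 2) //; apply: leq_trans (sum_degree_le G [set i; j]) _.
by rewrite cards2; case: (i != j) => /=; lia.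
Qed.

End Eigenvalue.

(** * The four inequalities *)

Section KirchhoffEigenvalueSums.
Variables (R : rcfType) (n : nat) (G : quiver n) (lam : n.-tuple R).
Hypothesis lamP : spectrum (kirchhoff G R) lam.

Lemma degree_sum_le_eigen_sum k : (0 < k <= n)%N ->
  (degree_sum G k)%:R <= eigen_sum lam k.
Proof.
case/andP=> k_gt0 kn; have [T Tk ->] := degree_sum_set G kn.
rewrite -Tk in k_gt0 *; rewrite natr_sum.
apply: le_trans (schur_top (kirchhoff_sym G R) lamP k_gt0).
by apply: ler_sum => i _; rewrite mxE eqxx.
Qed.

(** The edge sum of [X] is at most twice that of its diagonal, by [projection_sum_ge0]; the latter
    is the sum of p_i d_i, a weighted degree sum with total weight k. *)
Lemma eigen_sum_le_degree_sum k : (0 < k <= n)%N ->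
  eigen_sum lam k <= 2%:R * (degree_sum G k)%:R.
Proof.
move=> kn; have [_ k_le] := andP kn.
have [X [Y [XT XE trX <-]]] := top_eigenprojection (kirchhoff_sym G R) lamP k_le.
have X01 := projection_diag XE.
have /(ler_wpM2l (ler0n R 4)) := weighted_degree_le G X01 trX kn.
pose p := \row_i X i i.
have -> : \sum_i X i i * (degree G i)%:R = \tr (diag_mx p *m kirchhoff G R).
  by rewrite trace_diag_kirchhoff; apply: eq_bigr => i _; rewrite mxE.
move=> le_deg; rewrite -(ler_pM2l (ltr0n R 2)).
apply: le_trans (_ : 2%:R * (2%:R * \tr (diag_mx p *m kirchhoff G R)) <= _); last by lra.
rewrite !kirchhoff_trace ?tr_diag_mx // mulrDr.
have le_mul2 (x : R) : 0 <= x -> x <= 2%:R * x by lra.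
apply: lerD.
  rewrite !mulr_sumr; apply: ler_sum => i _; rewrite !mxE eqxx.
  have [Xi0 _] := andP (X01 i); rewrite mulr1n.
  by apply: le_mul2; rewrite !mulr_ge0.
rewrite mulr_sumr; apply: ler_sum => i _; rewrite mulr_sumr; apply: ler_sum => j ji.
rewrite mulrA; apply: ler_wpM2r => //; rewrite !mxE !eqxx eq_sym (negbTE ji).
have := projection_sum_ge0 XE i j; rewrite !mulr1n mulr0n; lra.
Qed.

Lemma degree_sum_le_bound_B k : (0 < k <= n)%N ->
  (degree_sum G k <= bound_B G k.-1)%N.
Proof.
case/andP=> k_gt0 kn; have [T Tk ->] := degree_sum_set G kn.
have := sum_degree_le G T; rewrite Tk /bound_B prednK // [X in (_ <= _ + X)%N]mulnC => le2.
(* An integer is at most the floor of x / 2 exactly when its double is at most x. *)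
by rewrite -leq_subLR leq_divRL // mulnBl leq_subLR ![(_ * 2)%N]mulnC.
Qed.

(** For p < 1, p (1 - p) phi(p) = p / 2 + 3 p^2 / 4. Hence the squares p_i^2 missing from the sum of
    p_i p_j over i <> j cancel exactly against those from phi. *)
Lemma eigen_sum_le k : (0 < k <= n)%N ->
  eigen_sum lam k
    <= (nb_edges G + redundancy G)%:R + 3%:R / 4%:R * k%:R ^+ 2 + k%:R / 2%:R.
Proof.
case/andP=> k_gt0 kn.
have [X [Y [XT XE trX <-]]] := top_eigenprojection (kirchhoff_sym G R) lamP kn.
have X01 := projection_diag XE.
pose phi (p : R) := (2%:R + 3%:R * p) / (4%:R * (1 - p)).
pose g i j := 3%:R / 2%:R * (X i i * X j j) + X i j ^+ 2 * (phi (X i i) + phi (X j j)).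
have Xsym i j : X j i = X i j by rewrite -[in LHS]XT mxE.
have phi_ge0 i : 0 <= phi (X i i).
  by rewrite /phi; have := X01 i => /andP[? ?]; rewrite divr_ge0 //; lra.
have Xij_le i j : i != j -> X i j ^+ 2 <= X i i * (1 - X i i).
  move=> ij; apply: le_trans (projection_row_le XE i).
  by rewrite (bigD1 j) 1?eq_sym //= lerDl sumr_ge0 // => l _; exact: sqr_ge0.
set N := (nb_edges G + redundancy G)%:R.
have gsum : \sum_i \sum_(j | j != i) g i j <= 3%:R / 2%:R * k%:R ^+ 2 + k%:R.
  pose sq (f : 'I_n -> 'I_n -> R) := \sum_i \sum_(j | j != i) f i j.
  have -> : \sum_i \sum_(j | j != i) g i j
     = 3%:R / 2%:R * sq (fun i j => X i i * X j j)
       + (sq (fun i j => X i j ^+ 2 * phi (X i i)) + sq (fun i j => X j i ^+ 2 * phi (X j j))).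
    rewrite /sq mulr_sumr -!big_split; apply: eq_bigr => i _.
    rewrite mulr_sumr -!big_split; apply: eq_bigr => j _.
    by rewrite /g (Xsym i j) /=; ring.
  have -> : sq (fun i j => X j i ^+ 2 * phi (X j j)) = sq (fun i j => X i j ^+ 2 * phi (X i i)).
    rewrite /sq (exchange_big_dep predT) //=; apply: eq_bigr => i _.
    by apply: eq_bigl => j; rewrite eq_sym.
  have -> : sq (fun i j => X i i * X j j) = k%:R ^+ 2 - \sum_i X i i ^+ 2.
    rewrite expr2 -[in RHS]trX mulr_suml -sumrB; apply: eq_bigr => i _.
    by rewrite -mulr_sumr trX -[in RHS]trX /mxtrace [in RHS](bigD1 i) //=; ring.
  have : sq (fun i j => X i j ^+ 2 * phi (X i i))
      <= \sum_i (X i i / 2%:R + 3%:R / 4%:R * X i i ^+ 2).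
    apply: ler_sum => i _; rewrite -mulr_suml.
    apply: le_trans (ler_wpM2r (phi_ge0 i) (projection_row_le XE i)) _.
    (* At p = 1 the left side is 0 and an inequality remains; elsewhere equality holds. *)
    rewrite /phi; have [->|p1] := eqVneq (X i i) 1; first by rewrite subrr mulr0 mul0r; lra.
    rewrite le_eqVlt; apply/orP; left; apply/eqP; field.
    by rewrite subr_eq0 eq_sym.
  rewrite big_split /= -mulr_suml -mulr_sumr -/(\tr X) trX; lra.
have X_le1 i : X i i <= 1 by have /andP[] := X01 i.
have g_ge0 i j : i != j -> 0 <= g i j.
  move=> _; have [? _] := andP (X01 i); have [? _] := andP (X01 j).
  rewrite /g; apply: addr_ge0; apply: mulr_ge0; try lra.
  - exact: mulr_ge0.
  - exact: sqr_ge0.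
  - exact: addr_ge0.
have diff_le i j : i != j -> X i i + X j j - 2%:R * X i j <= 1 + g i j.
  move=> ij; apply: edge_weight_ge => //; first exact: Xij_le.
  by rewrite -Xsym; apply: Xij_le; rewrite eq_sym.
have := kirchhoff_trace_le G XT X_le1 (fun i j => projection_diff_le2 XT XE) g_ge0 diff_le.
rewrite -/N; move: gsum; lra.
Qed.

Lemma eigen_sum_le_bound_H k : (0 < k <= n)%N ->
  eigen_sum lam k <= (bound_H G k)%:R.
Proof.
move=> kn; have [k1|k1] := eqVneq k 1%N.
  subst k; rewrite eigen_sumE //.
  have [_ n_gt0] := andP kn.
  rewrite (big_pred1 (Ordinal n_gt0)); last by move=> i; rewrite ltnS leqn0.
  apply: kirchhoff_eigenvalue_le; rewrite eigenvalue_root_char (proj2 lamP).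
  by rewrite root_prod_XsubC mem_tnth.
apply: le_trans (eigen_sum_le kn) _.
rewrite /bound_H [leRHS]natrD natrX -addrA lerD2l.
(* For k >= 2, k / 2 <= k^2 / 4. *)
have k2 : 2%:R <= k%:R :> R by rewrite ler_nat; move: kn k1; case: k => [|[|k]].
by nra.
Qed.

End KirchhoffEigenvalueSums.

Theorem theorem4 (R : rcfType) (n : nat) (n_gt0 : (0 < n)%N) (G : quiver n)
    (lam : n.-tuple R) (lamP : spectrum (kirchhoff G R) lam)
    (k : nat) (k_bounds : (1 <= k <= n)%N) :
  [/\ (degree_sum G k)%:R <= eigen_sum lam k,
      eigen_sum lam k <= 2%:R * (degree_sum G k)%:R,
      (degree_sum G k <= bound_B G k.-1)%N &
      eigen_sum lam k <= (bound_H G k)%:R].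
Proof.
split.
- exact: degree_sum_le_eigen_sum.
- exact: eigen_sum_le_degree_sum.
- exact: degree_sum_le_bound_B.
- exact: eigen_sum_le_bound_H.
Qed.
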